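(* Let $p>0$ be a prime, $k$ a field of characteristic $p$, and $G$ an elementary abelian $p$-group of order $q=p^n$ with $n\ge 1$. Let $W$ be a faithful indecomposable $kG$-module of dimension $2$, and for $1\le i\le q$ set $V_i = S^{i-1}(W)^*$. Let $M=\bigoplus_{s=1}^{p^{n-1}}V_{sp}$. Let $i,j$ be positive integers with $i<p$, $j<q$ and $i+j\le q$. Write $j=rp+j'$ with integers $r\ge 0$ and $0\le j'<p$, and assume that $i+j'\le p$. Then $$V_i\otimes V_j\cong_M\bigoplus_{l=1}^{\min(i,j')}V_{j+i-(2l-1)},$$ where $\cong_M$ denotes isomorphism in the stable module category relative to $M$.
   Context: All modules are finite-dimensional. $S^d(W)$ denotes the $d$-th symmetric power of $W$ over $k$ (with $S^0(W)=k$ trivial), and $*$ denotes the dual (contragredient) module. Tensor products are over $k$ with diagonal $G$-action. An empty direct sum is the zero module. A $kG$-module $P$ is projective relative to a $kG$-module $M$ if every short exact sequence of $kG$-modules $0\to X\to Y\to P\to 0$ splits whenever the tensored sequence $0\to M\otimes X\to M\otimes Y\to M\otimes P\to 0$ splits; equivalently, $P$ is a direct summand of $X\otimes M$ for some $kG$-module $X$. The stable module category relative to $M$ has $kG$-modules as objects and, as morphisms from $X$ to $Y$, the quotient of $\mathrm{Hom}_{kG}(X,Y)$ by the subspace of homomorphisms factoring through a module projective relative to $M$. One has $X\cong_M Y$ if and only if there exist $kG$-modules $P,Q$, each projective relative to $M$, with $X\oplus P\cong Y\oplus Q$. *)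

(* Defs.v *)
From mathcomp Require Import all_boot all_order all_algebra.
From mathcomp Require Import all_fingroup all_solvable all_field all_character.
From mathcomp Require Import mpoly.

Set Implicit Arguments.
Unset Strict Implicit.
Unset Printing Implicit Defensive.

Import GRing.Theory.
Local Open Scope ring_scope.

(* Finite-dimensional kG-modules are matrix representations acting on the      *)
(* right of row vectors: row a of [rG x] is the image of the a-th basis vector *)
(* under x.  [representation k G] packages a degree with a representation of   *)
(* that degree.                                                                *)

Section Constructions.

Variables (k : fieldType) (gT : finGroupType) (G : {group gT}).

Section OneModule.

Variables (n : nat) (rG : mx_representation k G n).

Definition mx_indecomposable : Prop :=
  (0 < n)%N /\
  forall U V : 'M[k]_n, mxmodule rG U -> mxmodule rG V ->
    (U + V :=: 1%:M)%MS -> mxdirect (U + V) -> U = 0 \/ V = 0.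

Lemma dual_mx_repr : mx_repr G (fun x => (rG x^-1%g)^T).
Proof.
split=> [|x y Gx Gy]; first by rewrite invg1 repr_mx1 trmx1.
by rewrite invMg repr_mxM ?groupV // trmx_mul.
Qed.

Definition dual_repr := MxRepresentation dual_mx_repr.

(* S^d is the space of homogeneous polynomials of degree d in the basis       *)
(* vectors 'X_0, ..., 'X_(n-1) of the module, on which x acts by linear       *)
(* substitution; its basis is the set of monomials of degree d.               *)
Definition monom (d : nat) := {m : 'X_{1..n < d.+1} | mdeg m == d}.

Definition lin_forms (A : 'M[k]_n) : n.-tuple {mpoly k[n]} :=
  [tuple \sum_(b < n) A a b *: 'X_b | a < n].

Definition sym_mx (d : nat) (A : 'M[k]_n) : 'M[k]_#|{: monom d}| :=
  \matrix_(i, j)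
    ('X_[val (val (enum_val i))] \mPo lin_forms A)@_(val (val (enum_val j))).

Lemma lin_forms1 : lin_forms 1%:M = [tuple 'X_a | a < n].
Proof.
apply: eq_from_tnth => a; rewrite !tnth_mktuple (bigD1 a) //= mxE eqxx scale1r.
rewrite big1 ?addr0 // => b nba.
by rewrite mxE eq_sym (negbTE nba) scale0r.
Qed.

Lemma comp_lin_formsM (A B : 'M[k]_n) (q : {mpoly k[n]}) :
  q \mPo lin_forms (A *m B) = (q \mPo lin_forms A) \mPo lin_forms B.
Proof.
rewrite [q \mPo lin_forms A]comp_mpolyEX [LHS]comp_mpolyEX raddf_sum /=.
apply: eq_bigr => m _; rewrite comp_mpolyZ; congr (_ *: _).
rewrite !comp_mpolyX rmorph_prod /=; apply: eq_bigr => a _.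
rewrite rmorphXn /=; congr (_ ^+ _); rewrite !tnth_mktuple raddf_sum /=.
transitivity (\sum_(c < n) \sum_(b < n) A a c *: (B c b *: 'X_b)
                : {mpoly k[n]}); last first.
  apply: eq_bigr => c _.
  by rewrite comp_mpolyZ comp_mpolyXU -tnth_nth tnth_mktuple scaler_sumr.
rewrite exchange_big; apply: eq_bigr => b _ /=.
by rewrite mxE scaler_suml; apply: eq_bigr => c _; rewrite scalerA.
Qed.

Lemma comp_lin_forms_homog d (m : 'X_{1..n}) (A : 'M[k]_n) :
  mdeg m = d -> 'X_[m] \mPo lin_forms A \is d.-homog.
Proof.
move=> <-; rewrite comp_mpolyX mdegE.
elim/big_rec2: _ => [|a e q _ hq]; first exact: dhomog1.
apply: dhomogM => //; rewrite -[X in X.-homog]mul1n; apply: dhomogMn.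
rewrite tnth_mktuple; apply: rpred_sum => b _; apply: rpredZ.
by rewrite dhomogX; apply/eqP/mdeg1.
Qed.

Lemma homog_sum_monom d (q : {mpoly k[n]}) : q \is d.-homog ->
  q = \sum_(i < #|{: monom d}|)
        q@_(val (val (enum_val i))) *: 'X_[val (val (enum_val i))].
Proof.
move=> hq; apply/mpolyP => m; rewrite raddf_sum /=.
under eq_bigr do rewrite mcoeffZ mcoeffX.
have [dm|ndm] := eqVneq (mdeg m) d; last first.
  rewrite (dhomog_nemf_coeff hq ndm) big1 // => i _.
  case: eqP => [e|_]; last by rewrite mulr0.
  by case/negP: ndm; rewrite -e; exact: (valP (enum_val i)).
have bm : (mdeg m < d.+1)%N by rewrite dm.
have pm : mdeg (BMultinom bm) == d by apply/eqP.
rewrite (bigD1 (enum_rank (exist _ (BMultinom bm) pm : monom d))) //=.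
rewrite enum_rankK /= eqxx mulr1 big1 ?addr0 // => i nei.
case: eqP => [e|_]; last by rewrite mulr0.
case/eqP: nei; rewrite -[i]enum_valK; congr enum_rank.
by apply: val_inj; apply: val_inj.
Qed.

Lemma sym_mx_repr d : mx_repr G (fun x => sym_mx d (rG x)).
Proof.
split=> [|x y Gx Gy].
  apply/matrixP => i j; rewrite repr_mx1 !mxE lin_forms1 comp_mpoly_id mcoeffX.
  by rewrite -(inj_eq enum_val_inj) -!val_eqE.
apply/matrixP => i j; rewrite repr_mxM // !mxE comp_lin_formsM.
have di : mdeg (val (val (enum_val i))) = d.
  by apply/eqP; exact: (valP (enum_val i)).
rewrite {1}(homog_sum_monom (comp_lin_forms_homog (rG x) di)).
rewrite (raddf_sum (comp_mpoly (lin_forms (rG y)))) raddf_sum /=.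
by apply: eq_bigr => l _; rewrite comp_mpolyZ mcoeffZ !mxE.
Qed.

Definition sym_repr (d : nat) := MxRepresentation (sym_mx_repr d).

End OneModule.

(* V_i = S^(i-1)(W)^*, meant for i >= 1. *)
Definition Vmod (n : nat) (W : mx_representation k G n) (i : nat) :
    representation k G :=
  Representation (dual_repr (sym_repr W i.-1)).

Definition tensor_grepr (X Y : representation k G) : representation k G :=
  Representation (prod_repr X Y).

End Constructions.

Section RelativeStableCategory.

Variables (k : fieldType) (gT : finGroupType) (G : {group gT}).
Local Notation kGmod := (representation k G).
Local Notation "''Mat' ( X , Y )" := 'M[k]_(rdegree X, rdegree Y)
  (at level 8, X, Y at level 2).

Definition is_hom (X Y : kGmod) (f : 'Mat(X, Y)) : Prop :=
  {in G, forall x, X x *m f = f *m Y x}.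

Definition short_exact (X Y Z : kGmod) (f : 'Mat(X, Y)) (g : 'Mat(Y, Z)) :
    Prop :=
  [/\ is_hom f, is_hom g, row_free f, row_full g & (f :=: kermx g)%MS].

Definition splits (Y Z : kGmod) (g : 'Mat(Y, Z)) : Prop :=
  exists2 s : 'Mat(Z, Y), is_hom s & s *m g = 1%:M.

Definition tensor_hom (M X Y : kGmod) (f : 'Mat(X, Y)) :
    'Mat((tensor_grepr M X), (tensor_grepr M Y)) :=
  tprod (1%:M : 'Mat(M, M)) f.

(* Since k is a field, M (x) - is exact, so the tensored sequence is always   *)
(* short exact.                                                               *)
Definition rel_projective (M P : kGmod) : Prop :=
  forall (X Y : kGmod) (f : 'Mat(X, Y)) (g : 'Mat(Y, P)),
    short_exact f g -> splits (tensor_hom M g) -> splits g.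

Definition factors_rel_proj (M X Y : kGmod) (f : 'Mat(X, Y)) : Prop :=
  exists2 P : kGmod, rel_projective M P &
    exists (a : 'Mat(X, P)) (b : 'Mat(P, Y)),
      [/\ is_hom a, is_hom b & f = a *m b].

(* Equality of morphisms of the stable module category relative to M. *)
Definition stable_eq (M X Y : kGmod) (f g : 'Mat(X, Y)) : Prop :=
  factors_rel_proj M (f - g).

Definition stable_iso (M X Y : kGmod) : Prop :=
  exists (f : 'Mat(X, Y)) (g : 'Mat(Y, X)),
    [/\ is_hom f, is_hom g,
        stable_eq M (f *m g : 'Mat(X, X)) 1%:M &
        stable_eq M (g *m f : 'Mat(Y, Y)) 1%:M].

End RelativeStableCategory.

(* Main.v *)
Require Import Defs.
From mathcomp Require Import all_boot all_order all_algebra.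
From mathcomp Require Import all_fingroup all_solvable all_field all_character.
From HB Require Import structures.
From mathcomp Require Import mpoly zify ring.

(** Everything happens one level before dualizing, with the symmetric powers
    S^d = S^d(W) seen as binary forms of degree d.  Since G has exponent p and k
    has characteristic p, every element of G acts on W with determinant 1, and
    the classical first step of the Clebsch-Gordan rule applies: multiplication
    S^(a+1) (x) S^(b+1) -> S^(a+b+2) has kernel S^a (x) S^b, embedded by
    multiplication by x_0 (x) x_1 - x_1 (x) x_0 (wedge_hom, wedge_free,
    wedge_mult).

    This sequence splits when the falling factorial (a+b+2)^_(a+1) is nonzero
    in k.  A section is obtained by polarizing a + 1 times: the operator
    sum_v x_v (x) d/dx_v moves one degree from the right factor to the left one,
    commutes with all linear substitutions by the chain rule (polar_hom) and, by
    the Euler identity, becomes multiplication by the right degree after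
    multiplying out (polar_mult).  Iterating from S^0 (x) S^c = S^c gives a map
    S^c -> S^a (x) S^(c-a) whose composite with multiplication is c^_a
    (mult_section).

    For i, j = r p + j' with i, j' > 0 and i + j' <= p, the factors of the
    relevant falling factorial are congruent mod p to numbers strictly between 0
    and p, so that, dually,
      V_i (x) V_j = V_(i+j-1) (+) V_(i-1) (x) V_(j-1)
    is a genuine isomorphism (Vmod_clebsch_gordan), the second summand being
    absent when i = 1 or j = 1.  Both i and j' have decreased, so this can be
    repeated min(i, j') times; it produces the summands of the theorem, and
    leaves either nothing or V_(i-j') (x) V_(r p) (Vmod_tensor_split).  The
    latter is projective relative to M because V_(r p) is a direct summand of M
    (rel_projective_tensor, by way of tensor_section), so it vanishes in the
    stable category. *)

Set Implicit Arguments.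
Unset Strict Implicit.
Unset Printing Implicit Defensive.

Import GRing.Theory.
Local Open Scope ring_scope.

(** * Kronecker products in coordinates *)

Lemma tensor_ord_subproof m n (i : 'I_m) (j : 'I_n) : (i * n + j < m * n)%N.
Proof.
apply: (@leq_trans (i.+1 * n)); first by rewrite mulSn addnC ltn_add2r.
by rewrite leq_mul2r ltn_ord orbT.
Qed.

(** The index of the basis vector e_i (x) e_j of a Kronecker product, the order
    being row-major. *)
Definition tensor_ord m n (i : 'I_m) (j : 'I_n) :=
  Ordinal (tensor_ord_subproof i j).

Lemma tensor_ord_mod_subproof m n (e : 'I_(m * n)) : (e %% n < n)%N.
Proof. by rewrite ltn_mod; case: n e => // -[? /[!muln0]]. Qed.

Lemma tensor_ord_div_subproof m n (e : 'I_(m * n)) : (e %/ n < m)%N.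
Proof. by rewrite ltn_divLR ?ltn_ord //; case: n e => // -[? /[!muln0]]. Qed.

Definition tensor_fst m n (e : 'I_(m * n)) :=
  Ordinal (tensor_ord_div_subproof e).
Definition tensor_snd m n (e : 'I_(m * n)) :=
  Ordinal (tensor_ord_mod_subproof e).

Lemma tensor_ordK m n (e : 'I_(m * n)) :
  tensor_ord (tensor_fst e) (tensor_snd e) = e.
Proof. by apply/val_inj; rewrite /= -divn_eq. Qed.

Lemma tensor_fstK m n (i : 'I_m) (j : 'I_n) : tensor_fst (tensor_ord i j) = i.
Proof.
apply/val_inj; rewrite /= divnMDl ?divn_small ?addn0 //.
exact: leq_ltn_trans (leq0n _) (ltn_ord j).
Qed.

Lemma tensor_sndK m n (i : 'I_m) (j : 'I_n) : tensor_snd (tensor_ord i j) = j.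
Proof. by apply/val_inj; rewrite /= modnMDl modn_small. Qed.

Lemma sum_tensor_ord (V : nmodType) m n (F : 'I_(m * n) -> V) :
  \sum_e F e = \sum_i \sum_j F (tensor_ord i j).
Proof.
rewrite pair_big /= (reindex (fun p : 'I_m * 'I_n => tensor_ord p.1 p.2)) //=.
exists (fun e => (tensor_fst e, tensor_snd e)) => [[i j]|e] _ /=.
  by rewrite tensor_fstK tensor_sndK.
exact: tensor_ordK.
Qed.

Section Tensor.
Variable F : fieldType.

Lemma tensor_matrixP m n m' n' (A B : 'M[F]_(m * n, m' * n')) :
  (forall i j i' j', A (tensor_ord i j) (tensor_ord i' j')
                   = B (tensor_ord i j) (tensor_ord i' j')) -> A = B.
Proof.
move=> eAB; apply/matrixP => e e'.
by rewrite -[e]tensor_ordK -[e']tensor_ordK.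
Qed.

Lemma trowE n1 (A : 'rV[F]_n1) m2 n2 (B : 'M[F]_(m2, n2)) i j i' :
  trow A B i (tensor_ord j i') = A 0 j * B i i'.
Proof.
elim: n1 A j => [A []//|n1 IH] A j /=.
case: (unliftP 0 j) => [j1 ->|->].
  have -> : tensor_ord (lift 0 j1) i' = rshift n2 (tensor_ord j1 i').
    by apply/val_inj; rewrite /= /bump leq0n mulSn addnA.
  by rewrite row_mxEr IH mxE; congr (A 0 _ * _); apply/val_inj.
have -> : tensor_ord (ord0 : 'I_n1.+1) i' = lshift (n1 * n2) i'.
  exact/val_inj.
by rewrite row_mxEl !mxE; congr (A 0 _ * _); apply/val_inj.
Qed.

Lemma tprod_ordE m1 n1 (A : 'M[F]_(m1, n1)) m2 n2 (B : 'M[F]_(m2, n2))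
    i j i' j' :
  tprod A B (tensor_ord i j) (tensor_ord i' j') = A i i' * B j j'.
Proof.
elim: m1 A i => [A []//|m1 IH] A i /=.
case: (unliftP 0 i) => [i1 ->|->].
  have -> : tensor_ord (lift 0 i1) j = rshift m2 (tensor_ord i1 j).
    by apply/val_inj; rewrite /= /bump leq0n mulSn addnA.
  by rewrite col_mxEd IH mxE; congr (A _ _ * _); apply/val_inj.
have -> : tensor_ord (ord0 : 'I_m1.+1) j = lshift (m1 * m2) j by apply/val_inj.
by rewrite col_mxEu trowE !mxE; congr (A _ _ * _); apply/val_inj.
Qed.

Lemma tprodDl m1 n1 m2 n2 (A A' : 'M[F]_(m1, n1)) (B : 'M[F]_(m2, n2)) :
  tprod (A + A') B = tprod A B + tprod A' B.
Proof.
by apply: tensor_matrixP => *; rewrite !(tprod_ordE, mxE) mulrDl.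
Qed.

Lemma tprodDr m1 n1 m2 n2 (A : 'M[F]_(m1, n1)) (B B' : 'M[F]_(m2, n2)) :
  tprod A (B + B') = tprod A B + tprod A B'.
Proof.
by apply: tensor_matrixP => *; rewrite !(tprod_ordE, mxE) mulrDr.
Qed.

Lemma tprod0l m1 n1 m2 n2 (B : 'M[F]_(m2, n2)) :
  tprod (0 : 'M[F]_(m1, n1)) B = 0.
Proof. by apply: tensor_matrixP => *; rewrite tprod_ordE !mxE mul0r. Qed.

Lemma tprod0r m1 n1 m2 n2 (A : 'M[F]_(m1, n1)) :
  tprod A (0 : 'M[F]_(m2, n2)) = 0.
Proof. by apply: tensor_matrixP => *; rewrite tprod_ordE !mxE mulr0. Qed.

Lemma tprodZl m1 n1 m2 n2 c (A : 'M[F]_(m1, n1)) (B : 'M[F]_(m2, n2)) :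
  tprod (c *: A) B = c *: tprod A B.
Proof.
by apply: tensor_matrixP => *; rewrite !(tprod_ordE, mxE) mulrA.
Qed.

Lemma tprodZr m1 n1 m2 n2 c (A : 'M[F]_(m1, n1)) (B : 'M[F]_(m2, n2)) :
  tprod A (c *: B) = c *: tprod A B.
Proof.
by apply: tensor_matrixP => *; rewrite !(tprod_ordE, mxE) mulrCA.
Qed.

Lemma tprod_suml m1 n1 m2 n2 I (r : seq I) P (A : I -> 'M[F]_(m1, n1))
    (B : 'M[F]_(m2, n2)) :
  tprod (\sum_(i <- r | P i) A i) B = \sum_(i <- r | P i) tprod (A i) B.
Proof.
apply: (big_morph (fun A => tprod A B)) => [A1 A2|].
  exact: tprodDl.
exact: tprod0l.
Qed.

Lemma tprod_sumr m1 n1 m2 n2 I (r : seq I) P (A : 'M[F]_(m1, n1))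
    (B : I -> 'M[F]_(m2, n2)) :
  tprod A (\sum_(i <- r | P i) B i) = \sum_(i <- r | P i) tprod A (B i).
Proof.
apply: (big_morph (fun B => tprod A B)) => [B1 B2|].
  exact: tprodDr.
exact: tprod0r.
Qed.

Lemma trmx_tprod m1 n1 m2 n2 (A : 'M[F]_(m1, n1)) (B : 'M[F]_(m2, n2)) :
  (tprod A B)^T = tprod A^T B^T.
Proof. by apply: tensor_matrixP => *; rewrite mxE !tprod_ordE !mxE. Qed.

(** The matrix of the linear map induced on a tensor product by the bilinear map
    whose value on the pair (e_i, e_j) of basis vectors is f i j. *)
Definition bilin_mx m n c (f : 'I_m -> 'I_n -> 'rV[F]_c) : 'M[F]_(m * n, c) :=
  \matrix_(e < m * n) f (tensor_fst e) (tensor_snd e).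

Lemma row_bilin_mx m n c (f : 'I_m -> 'I_n -> 'rV[F]_c) i j :
  row (tensor_ord i j) (bilin_mx f) = f i j.
Proof. by rewrite rowK tensor_fstK tensor_sndK. Qed.

Lemma tensor_rowP m n c (A B : 'M[F]_(m * n, c)) :
  (forall i j, row (tensor_ord i j) A = row (tensor_ord i j) B) -> A = B.
Proof. by move=> eAB; apply/row_matrixP => e; rewrite -[e]tensor_ordK. Qed.

Lemma row_tprod_mul m n m' n' c (A : 'M[F]_(m, m')) (B : 'M[F]_(n, n'))
    (C : 'M[F]_(m' * n', c)) i j :
  row (tensor_ord i j) (tprod A B *m C)
  = \sum_i' \sum_j' (A i i' * B j j') *: row (tensor_ord i' j') C.
Proof.
rewrite row_mul mulmx_sum_row sum_tensor_ord.
by apply: eq_bigr => i' _; apply: eq_bigr => j' _; rewrite mxE tprod_ordE.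
Qed.

(** This is tprod u w, with row dimension literally 1 instead of 1 * 1. *)
Definition tensor_vec m n (u : 'rV[F]_m) (w : 'rV[F]_n) : 'rV[F]_(m * n) :=
  \row_e (u 0 (tensor_fst e) * w 0 (tensor_snd e)).

Lemma tensor_vecE m n (u : 'rV[F]_m) (w : 'rV[F]_n) i j :
  tensor_vec u w 0 (tensor_ord i j) = u 0 i * w 0 j.
Proof. by rewrite mxE tensor_fstK tensor_sndK. Qed.

Lemma tensor_vec_mul m n c (u : 'rV[F]_m) (w : 'rV[F]_n)
    (C : 'M[F]_(m * n, c)) :
  tensor_vec u w *m C
  = \sum_i \sum_j (u 0 i * w 0 j) *: row (tensor_ord i j) C.
Proof.
rewrite mulmx_sum_row sum_tensor_ord.
by apply: eq_bigr => i _; apply: eq_bigr => j _; rewrite tensor_vecE.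
Qed.

Lemma row_tprod m n m' n' (A : 'M[F]_(m, m')) (B : 'M[F]_(n, n')) i j :
  row (tensor_ord i j) (tprod A B) = tensor_vec (row i A) (row j B).
Proof.
by apply/rowP => e; rewrite -[e]tensor_ordK tensor_vecE !mxE tprod_ordE.
Qed.

Lemma tensor_vec_tprod m n m' n' (u : 'rV[F]_m) (w : 'rV[F]_n)
    (A : 'M[F]_(m, m')) (B : 'M[F]_(n, n')) :
  tensor_vec u w *m tprod A B = tensor_vec (u *m A) (w *m B).
Proof.
apply/rowP => e; rewrite -[e]tensor_ordK.
rewrite tensor_vecE !mxE sum_tensor_ord mulr_suml.
apply: eq_bigr => i _; rewrite mulr_sumr; apply: eq_bigr => j _.
by rewrite tensor_vecE tprod_ordE mulrACA.
Qed.

Lemma tensor_vec_suml m n I (r : seq I) (c : I -> F) (u : I -> 'rV[F]_m)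
    (w : 'rV[F]_n) :
  tensor_vec (\sum_(x <- r) c x *: u x) w
  = \sum_(x <- r) c x *: tensor_vec (u x) w.
Proof.
apply/rowP => e; rewrite mxE !summxE mulr_suml.
by apply: eq_bigr => x _; rewrite !mxE mulrA.
Qed.

Lemma tensor_vec_sumr m n I (r : seq I) (c : I -> F) (u : 'rV[F]_m)
    (w : I -> 'rV[F]_n) :
  tensor_vec u (\sum_(x <- r) c x *: w x)
  = \sum_(x <- r) c x *: tensor_vec u (w x).
Proof.
apply/rowP => e; rewrite mxE !summxE mulr_sumr.
by apply: eq_bigr => x _; rewrite !mxE mulrCA.
Qed.

Lemma sum_row1 m (p : 'rV[F]_m) : p = \sum_j p 0 j *: row j 1%:M.
Proof. by rewrite -mulmx_sum_row mulmx1. Qed.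

End Tensor.

(* Products of matrices with a single row would otherwise be unfolded by /=. *)
Arguments tprod : simpl never.

(** * Operators on homogeneous polynomials *)

Definition mon n d (i : 'I_#|{: monom n d}|) : 'X_{1..n} :=
  val (val (enum_val i)).

Lemma mdeg_mon n d (i : 'I_#|{: monom n d}|) : mdeg (mon i) = d.
Proof. by apply/eqP; apply: (valP (enum_val i)). Qed.

Lemma mon_inj n d : injective (@mon n d).
Proof. by move=> i j /val_inj /val_inj /enum_val_inj. Qed.

Lemma mon_surj n d (m : 'X_{1..n}) :
  mdeg m = d -> exists i : 'I_#|{: monom n d}|, mon i = m.
Proof.
move=> dm; have bm : (mdeg m < d.+1)%N by rewrite dm.
have pm : mdeg (BMultinom bm) == d by apply/eqP.
exists (enum_rank (exist _ (BMultinom bm) pm : monom n d)).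
by rewrite /mon enum_rankK.
Qed.

Lemma card_monom2 d : #|{: monom 2 d}| = d.+1.
Proof.
apply: etrans (card_ord d.+1).
have lt_e (m : monom 2 d) : (val (val m) ord0 < d.+1)%N.
  apply: leq_trans (_ : (mdeg (val (val m))).+1 <= d.+1)%N.
    by rewrite ltnS mdegE big_ord_recl leq_addr.
  by have /eqP -> := valP m.
apply: (bij_eq_card (f := fun m => Ordinal (lt_e m))).
pose mk (e : 'I_d.+1) :=
  [multinom (if v == ord0 then val e else d - e)%N | v < 2].
have deg_mk e : mdeg (mk e) = d.
  by rewrite mdegE !big_ord_recl big_ord0 !mnmE /= addn0 subnKC // -ltnS.
have bnd e : (mdeg (mk e) < d.+1)%N by rewrite deg_mk.
have prf e : mdeg (BMultinom (bnd e)) == d by apply/eqP/deg_mk.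
exists (fun e => exist _ (BMultinom (bnd e)) (prf e) : monom 2 d) => [m|e].
  apply/val_inj/val_inj/mnmP => v /=; rewrite mnmE.
  have /eqP := valP m; rewrite mdegE !big_ord_recl big_ord0 addn0 /= => dm.
  case: (unliftP ord0 v) => [v1 ->|->] //=.
  by rewrite [v1]ord1 -{1}dm addKn.
by apply/val_inj; rewrite /= mnmE.
Qed.

Lemma mnm_subU1K n (m : 'X_{1..n}) (v : 'I_n) :
  m v != 0%N -> (m - U_(v) + U_(v))%MM = m.
Proof.
move=> nz; apply/submK/mnm_lepP => u.
by rewrite mnm1E; case: eqP => // <-; rewrite lt0n.
Qed.

Lemma mnm_subU1 n (v : 'I_n) : (U_(v) - U_(v))%MM = 0%MM.
Proof. by apply/mnmP => u; rewrite mnmBE mnm0E subnn. Qed.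

Section Polynomials.
Variables (k : fieldType) (n : nat).
Implicit Types (A : 'M[k]_n) (v w : 'I_n).
Local Notation poly := {mpoly k[n]}.
Local Notation N d := #|{: monom n d%N}|.

(** Restricted to forms of degree c and truncated to degree d, so that operators
    of any degree are treated alike: sym_mx d A is the case c = d with phi the
    substitution by A. *)
Definition homog_mx c d (phi : poly -> poly) : 'M[k]_(N c, N d) :=
  \matrix_(i, j) (phi 'X_[mon i])@_(mon j).

Lemma homog_mxM c d e (phi : poly -> poly) (psi : {linear poly -> poly}) :
  (forall m, mdeg m = c -> phi 'X_[m] \is d.-homog) ->
  homog_mx c d phi *m homog_mx d e psi = homog_mx c e (psi \o phi).
Proof.
move=> hphi; apply/matrixP => i j; rewrite !mxE /=.
rewrite [in RHS](homog_sum_monom (hphi _ (mdeg_mon i))) linear_sum raddf_sum /=.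
by apply: eq_bigr => l _; rewrite linearZ mcoeffZ !mxE.
Qed.

Lemma eq_homog_mx c d (phi psi : poly -> poly) :
  phi =1 psi -> homog_mx c d phi = homog_mx c d psi.
Proof. by move=> e; apply/matrixP => i j; rewrite !mxE e. Qed.

Lemma homog_mx_sum c d I (r : seq I) (P : pred I) (a : I -> k)
    (phi : I -> poly -> poly) :
  homog_mx c d (fun q => \sum_(x <- r | P x) a x *: phi x q)
  = \sum_(x <- r | P x) a x *: homog_mx c d (phi x).
Proof.
apply/matrixP => i j; rewrite mxE raddf_sum summxE /=.
by apply: eq_bigr => x _; rewrite mcoeffZ !mxE.
Qed.

Definition mulX v (q : poly) : poly := 'X_v * q.

Lemma mulX_is_linear v : linear (mulX v).
Proof. by move=> c p q; rewrite /mulX mulrDr scalerAr. Qed.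

HB.instance Definition _ v :=
  GRing.isLinear.Build k poly poly _ (mulX v) (mulX_is_linear v).

Definition mulX_mx v d := homog_mx d d.+1 (mulX v).
Definition deriv_mx v d := homog_mx d.+1 d (mderiv v).

Lemma sym_mxE d A : sym_mx d A = homog_mx d d (comp_mpoly (lin_forms A)).
Proof. by []. Qed.

Lemma mulX_mxE v d i j : mulX_mx v d i j = (mon j == (mon i + U_(v))%MM)%:R.
Proof. by rewrite mxE /mulX -mpolyXD mcoeffX addmC eq_sym. Qed.

Lemma mulX_homog v d (m : 'X_{1..n}) :
  mdeg m = d -> mulX v 'X_[m] \is d.+1.-homog.
Proof. by move=> dm; rewrite /mulX -mpolyXD dhomogX /= mdegD mdeg1 dm. Qed.

Lemma mderiv_homog v d (m : 'X_{1..n}) :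
  mdeg m = d.+1 -> (mderiv v 'X_[m] : poly) \is d.-homog.
Proof.
move=> dm; rewrite mderivX; have [->|nz] := eqVneq (m v) 0%N.
  by rewrite scale0r rpred0.
apply: rpredZ; rewrite dhomogX /=; apply/eqP/succn_inj.
by rewrite -dm -{2}(mnm_subU1K nz) mdegD mdeg1 addn1.
Qed.

Lemma comp_lin_homog A d (m : 'X_{1..n}) :
  mdeg m = d -> ('X_[m] \mPo lin_forms A : poly) \is d.-homog.
Proof. exact: comp_lin_forms_homog. Qed.

(** Substitution is multiplicative and sends x_v to sum_w A v w x_w. *)
Lemma mulX_sym d v A :
  mulX_mx v d *m sym_mx d.+1 A = \sum_w A v w *: (sym_mx d A *m mulX_mx w d).
Proof.
rewrite !sym_mxE homog_mxM; last exact: mulX_homog.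
under eq_bigr do rewrite (homog_mxM _ _ (@comp_lin_homog A d)).
rewrite -homog_mx_sum; apply: eq_homog_mx => q /=.
rewrite /mulX rmorphM /= comp_mpolyXU -tnth_nth tnth_mktuple mulr_suml.
by apply: eq_bigr => w _; rewrite scalerAl.
Qed.

(** The chain rule for a linear substitution.  Both sides are derivations along
    the substitution, so that it suffices to compare them on the variables. *)
Lemma mderiv_comp_lin A w (q : poly) :
  mderiv w (q \mPo lin_forms A)
  = \sum_v A v w *: (mderiv v q \mPo lin_forms A).
Proof.
pose P (r : poly) := mderiv w (r \mPo lin_forms A)
  = \sum_v A v w *: (mderiv v r \mPo lin_forms A).
have PC c : P c%:MP.
  rewrite /P comp_mpolyC mderivC big1 // => v _.
  by rewrite mderivC comp_mpoly0 scaler0.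
have PM r s : P r -> P s -> P (r * s).
  rewrite /P rmorphM /= mderivM => -> ->.
  rewrite mulr_suml mulr_sumr -big_split; apply: eq_bigr => v _ /=.
  by rewrite mderivM rmorphD !rmorphM /= scalerDr scalerAl scalerAr.
have PX v : P 'X_v.
  rewrite /P comp_mpolyXU -tnth_nth tnth_mktuple raddf_sum /=.
  transitivity ((A v w)%:MP : poly).
    rewrite (bigD1 w) //= big1 => [|u nuw]; rewrite mderivZ mderivX mnm1E.
      by rewrite eqxx addr0 scale1r mnm_subU1 mpolyX0 -mul_mpolyC mulr1.
    by rewrite (negbTE nuw) scale0r scaler0.
  rewrite (bigD1 v) //= big1 => [|u nuv]; rewrite mderivX mnm1E.
    rewrite eqxx addr0 scale1r mnm_subU1 mpolyX0 comp_mpoly1.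
    by rewrite -mul_mpolyC mulr1.
  by rewrite eq_sym (negbTE nuv) scale0r comp_mpoly0 scaler0.
have PXm m : P 'X_[m].
  rewrite mpolyXE_id; apply: (big_ind P) => [||v _]; first exact: (PC 1).
    exact: PM.
  by elim: (m v) => [|e IH]; [exact: (PC 1) | rewrite exprS; apply: PM].
elim/mpolyind: q => [|c m r _ _ IH].
  by have := PC 0; rewrite mpolyC0.
rewrite raddfD /= comp_mpolyZ raddfD /= mderivZ IH PXm scaler_sumr -big_split.
apply: eq_bigr => v _ /=.
by rewrite mderivD mderivZ raddfD /= comp_mpolyZ scalerDr !scalerA mulrC.
Qed.

Lemma sym_deriv d w A :
  sym_mx d.+1 A *m deriv_mx w d = \sum_v A v w *: (deriv_mx v d *m sym_mx d A).
Proof.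
rewrite !sym_mxE homog_mxM; last exact: comp_lin_homog.
under eq_bigr => v _ do rewrite (homog_mxM _ _ (@mderiv_homog v d)).
rewrite -homog_mx_sum; apply: eq_homog_mx => q /=; exact: mderiv_comp_lin.
Qed.

(** The Euler identity for forms of degree d + 1. *)
Lemma sum_deriv_mulX d : \sum_v deriv_mx v d *m mulX_mx v d = d.+1%:R%:M.
Proof.
under eq_bigr => v _ do rewrite (homog_mxM _ _ (@mderiv_homog v d)).
apply/matrixP => i j; rewrite summxE.
transitivity (\sum_v (mon i v)%:R * ('X_[mon i] : poly)@_(mon j)).
  apply: eq_bigr => v _; rewrite mxE /= /mulX mderivX -scalerAr mcoeffZ.
  have [->|nz] := eqVneq (mon i v) 0%N; first by rewrite !mul0r.
  by rewrite -mpolyXD addmC mnm_subU1K.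
rewrite -mulr_suml -natr_sum -mdegE mdeg_mon mcoeffX (inj_eq (@mon_inj _ _)).
by rewrite !mxE mulr_natr.
Qed.

Lemma mulX_comm v w d :
  mulX_mx v d *m mulX_mx w d.+1 = mulX_mx w d *m mulX_mx v d.+1.
Proof.
rewrite !homog_mxM; try exact: mulX_homog.
by apply: eq_homog_mx => q /=; rewrite /mulX mulrCA.
Qed.

End Polynomials.

(** * Multiplication, polarization and wedge maps *)

Section Polarization.
Variables (k : fieldType) (n : nat).
Implicit Types (A : 'M[k]_n) (v w : 'I_n).
Local Notation N d := #|{: monom n d%N}|.
Local Notation sym2 a b A := (tprod (sym_mx a A) (sym_mx b A)).

Lemma mx1E m (i j : 'I_m) : (1%:M : 'M[k]_m) i j = (i == j)%:R.
Proof. by rewrite mxE. Qed.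

(** Multiplication of forms; the target degree c is a separate parameter, meant
    to equal a + b, which spares casts along equations between degrees. *)
Definition mult_mx a b c : 'M[k]_(N a * N b, N c) :=
  bilin_mx (fun i j => \row_l (mon l == (mon i + mon j)%MM)%:R).

Lemma mulX_mult_l v a b c : (a + b)%N = c ->
  tprod (mulX_mx k v a) 1%:M *m mult_mx a.+1 b c.+1
  = mult_mx a b c *m mulX_mx k v c.
Proof.
move=> dc; apply: tensor_rowP => i j.
rewrite row_tprod_mul row_mul row_bilin_mx.
have [i' di'] : exists i' : 'I_(N a.+1), mon i' = (mon i + U_(v))%MM.
  by apply: mon_surj; rewrite mdegD mdeg1 mdeg_mon addn1.
have [l' dl'] : exists l' : 'I_(N c), mon l' = (mon i + mon j)%MM.
  by apply: mon_surj; rewrite mdegD !mdeg_mon.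
rewrite (bigD1 i') //= [X in _ + X]big1 => [|i1 ni]; last first.
  rewrite big1 // => j1 _.
  by rewrite mulX_mxE -di' (inj_eq (@mon_inj _ _)) (negbTE ni) mul0r scale0r.
rewrite (bigD1 j) //= big1 => [|j1 nj]; last first.
  by rewrite mx1E eq_sym (negbTE nj) mulr0 scale0r.
rewrite mulX_mxE di' mx1E !eqxx mulr1 scale1r !addr0 row_bilin_mx.
apply/rowP => l; rewrite !mxE (bigD1 l') //= big1 => [|l1 nl]; last first.
  by rewrite mxE -dl' (inj_eq (@mon_inj _ _)) (negbTE nl) mul0r.
rewrite mulX_mxE mxE -dl' eqxx mul1r addr0 di' dl'.
by rewrite -!addmA [(U_(v) + _)%MM]addmC.
Qed.

Lemma mulX_mult_r v a b c : (a + b)%N = c ->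
  tprod 1%:M (mulX_mx k v b) *m mult_mx a b.+1 c.+1
  = mult_mx a b c *m mulX_mx k v c.
Proof.
move=> dc; apply: tensor_rowP => i j.
rewrite row_tprod_mul row_mul row_bilin_mx.
have [j' dj'] : exists j' : 'I_(N b.+1), mon j' = (mon j + U_(v))%MM.
  by apply: mon_surj; rewrite mdegD mdeg1 mdeg_mon addn1.
have [l' dl'] : exists l' : 'I_(N c), mon l' = (mon i + mon j)%MM.
  by apply: mon_surj; rewrite mdegD !mdeg_mon.
rewrite (bigD1 i) //= [X in _ + X]big1 => [|i1 ni]; last first.
  by rewrite big1 // => j1 _; rewrite mx1E eq_sym (negbTE ni) mul0r scale0r.
rewrite (bigD1 j') //= big1 => [|j1 nj]; last first.
  by rewrite mulX_mxE -dj' (inj_eq (@mon_inj _ _)) (negbTE nj) mulr0 scale0r.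
rewrite mulX_mxE dj' mx1E !eqxx mulr1 scale1r !addr0 row_bilin_mx.
apply/rowP => l; rewrite !mxE (bigD1 l') //= big1 => [|l1 nl]; last first.
  by rewrite mxE -dl' (inj_eq (@mon_inj _ _)) (negbTE nl) mul0r.
by rewrite mulX_mxE mxE -dl' eqxx mul1r addr0 dj' dl' addmA.
Qed.

(** The polarization operator sum_v x_v (x) d/dx_v. *)
Definition polar_mx a b : 'M[k]_(N a * N b.+1, N a.+1 * N b) :=
  \sum_v tprod (mulX_mx k v a) (deriv_mx k v b).

(** The matrix A acts on the variables as it does on the derivations, but from
    the other side, so that the two actions cancel in the sum over v. *)
Lemma polar_hom a b A :
  sym2 a b.+1 A *m polar_mx a b = polar_mx a b *m sym2 a.+1 b A.
Proof.
rewrite mulmx_sumr mulmx_suml.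
transitivity (\sum_w \sum_v
    A v w *: tprod (sym_mx a A *m mulX_mx k w a)
                   (deriv_mx k v b *m sym_mx b A)).
  apply: eq_bigr => w _; rewrite -tprodE sym_deriv tprod_sumr.
  by apply: eq_bigr => v _; rewrite tprodZr.
rewrite exchange_big; apply: eq_bigr => v _ /=.
rewrite -tprodE mulX_sym tprod_suml.
by apply: eq_bigr => w _; rewrite tprodZl.
Qed.

(** Multiplying out x_v f (x) dg/dx_v and summing over v gives f times the Euler
    operator applied to g. *)
Lemma polar_mult a b c : (a + b)%N = c ->
  polar_mx a b *m mult_mx a.+1 b c.+1 = b.+1%:R *: mult_mx a b.+1 c.+1.
Proof.
move=> dc; rewrite mulmx_suml.
transitivity (\sum_v tprod 1%:M (deriv_mx k v b *m mulX_mx k v b)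
                *m mult_mx a b.+1 c.+1).
  apply: eq_bigr => v _.
  have -> : tprod (mulX_mx k v a) (deriv_mx k v b)
      = tprod 1%:M (deriv_mx k v b) *m tprod (mulX_mx k v a) 1%:M.
    by rewrite -tprodE mul1mx mulmx1.
  have -> : tprod (1%:M : 'M_(N a)) (deriv_mx k v b *m mulX_mx k v b)
      = tprod 1%:M (deriv_mx k v b) *m tprod 1%:M (mulX_mx k v b).
    by rewrite -tprodE mul1mx.
  by rewrite -!mulmxA mulX_mult_l // mulX_mult_r.
rewrite -mulmx_suml -tprod_sumr sum_deriv_mulX.
by rewrite -[b.+1%:R%:M]scalemx1 tprodZr tprod1 -scalemxAl mul1mx.
Qed.

Lemma sym_mx0 A : sym_mx 0 A = 1%:M.
Proof.
apply/matrixP => i j; rewrite !mxE -/(mon i) -/(mon j).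
have m0 (l : 'I_(N 0)) : mon l = 0%MM by apply/eqP; rewrite -mdeg_eq0 mdeg_mon.
have -> : i = j by apply: mon_inj; rewrite !m0.
by rewrite m0 mpolyX0 comp_mpoly1 mcoeff1 !eqxx.
Qed.

(** Polarizing a times after the identification of S^c with S^0 (x) S^c; the
    scalar is the product of the successive degrees c, c - 1, ... of the right
    factor. *)
Lemma mult_section a : forall b c, (a + b)%N = c ->
  exists s : 'M[k]_(N c, N a * N b),
    (forall A, sym_mx c A *m s = s *m sym2 a b A) /\
    s *m mult_mx a b c = (c ^_ a)%:R%:M.
Proof.
elim: a => [|a IH] b c dc.
  rewrite add0n in dc; rewrite {b}dc.
  have [i0 di0] : exists i : 'I_(N 0), mon i = 0%MM.
    by apply: mon_surj; rewrite mdeg0.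
  have uniq_i i : i = i0.
    by apply: mon_inj; apply/eqP; rewrite di0 -mdeg_eq0 mdeg_mon.
  have sum_i (V : nmodType) (G : 'I_(N 0) -> V) : \sum_i G i = G i0.
    by rewrite (bigD1 i0) //= big1 ?addr0 // => i; rewrite [i]uniq_i eqxx.
  (* The map f |-> 1 (x) f. *)
  exists (\matrix_(l, e) (l == tensor_snd e)%:R).
  split=> [A|]; apply/matrixP => l e.
    rewrite -[e]tensor_ordK sym_mx0 !mxE sum_tensor_ord sum_i.
    rewrite [RHS](bigD1 l) //= [X in _ + X]big1 => [|j nj].
      rewrite addr0 mxE tensor_sndK eqxx mul1r tprod_ordE [tensor_fst e]uniq_i.
      rewrite mxE eqxx mul1r.
      rewrite (bigD1 (tensor_snd e)) //= big1 => [|j nj].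
        by rewrite addr0 mxE tensor_sndK eqxx mulr1.
      by rewrite mxE tensor_sndK (negbTE nj) mulr0.
    by rewrite mxE tensor_sndK eq_sym (negbTE nj) mul0r.
  rewrite !mxE sum_tensor_ord sum_i (bigD1 l) //= big1 => [|j nj].
    rewrite addr0 !mxE !tensor_sndK tensor_fstK eqxx mul1r ffactn0 di0 add0m.
    by rewrite (inj_eq (@mon_inj _ _)) eq_sym.
  by rewrite mxE tensor_sndK eq_sym (negbTE nj) mul0r.
case: c dc => // c; rewrite addSn => /succn_inj dc.
have [|s [hom_s s_mult]] := IH b.+1 c.+1; first by rewrite addnS dc.
exists (s *m polar_mx a b); split=> [A|].
  by rewrite mulmxA hom_s -!mulmxA polar_hom.
rewrite -mulmxA polar_mult // -scalemxAr s_mult scale_scalar_mx -natrM.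
have -> : b.+1 = (c.+1 - a)%N by rewrite -dc -addnS addKn.
by rewrite ffactnSr mulnC.
Qed.

(** Multiplication by x_v (x) x_w - x_w (x) x_v. *)
Definition wedge_mx v w a b : 'M[k]_(N a * N b, N a.+1 * N b.+1) :=
  tprod (mulX_mx k v a) (mulX_mx k w b) - tprod (mulX_mx k w a) (mulX_mx k v b).

Lemma wedge_mult v w a b c : (a + b)%N = c ->
  wedge_mx v w a b *m mult_mx a.+1 b.+1 c.+2 = 0.
Proof.
move=> dc.
have two u u' : tprod (mulX_mx k u a) (mulX_mx k u' b) *m mult_mx a.+1 b.+1 c.+2
    = mult_mx a b c *m (mulX_mx k u' c *m mulX_mx k u c.+1).
  rewrite -[mulX_mx k u a]mul1mx -[mulX_mx k u' b]mulmx1 tprodE -mulmxA.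
  rewrite mulX_mult_l ?addnS ?dc // mulmxA mulX_mult_r //.
  by rewrite mulmxA.
by rewrite mulmxBl !two mulX_comm subrr.
Qed.

(** If u is in the kernel, comparing coefficients at the product of
    m_i x_v (x) m_j x_w shows that the coefficient of u at (m_i, m_j) equals its
    coefficient at (m_i x_v / x_w, m_j x_w / x_v), or 0 if this is not a pair of
    monomials.  The exponent of x_w in the left monomial has dropped, whence an
    induction on that exponent. *)
Lemma wedge_free v w a b : v != w -> row_free (wedge_mx v w a b).
Proof.
move=> nvw; rewrite -kermx_eq0; apply/rowV0P => u /sub_kermxP uK.
suff u0 e i j : (mon i w < e)%N -> u 0 (tensor_ord i j) = 0.
  apply/rowP => e; rewrite -[e]tensor_ordK.
  by rewrite (u0 (mon (tensor_fst e) w).+1) // mxE.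
elim: e i j => // e IH i j; rewrite ltnS => le_e.
have [i' di'] : exists i' : 'I_(N a.+1), mon i' = (mon i + U_(v))%MM.
  by apply: mon_surj; rewrite mdegD mdeg1 mdeg_mon addn1.
have [j' dj'] : exists j' : 'I_(N b.+1), mon j' = (mon j + U_(w))%MM.
  by apply: mon_surj; rewrite mdegD mdeg1 mdeg_mon addn1.
have term i1 j1 : u 0 (tensor_ord i1 j1)
      * wedge_mx v w a b (tensor_ord i1 j1) (tensor_ord i' j')
    = u 0 (tensor_ord i1 j1) * ((i1 == i) && (j1 == j))%:R.
  have -> : wedge_mx v w a b (tensor_ord i1 j1) (tensor_ord i' j')
      = ((i1 == i) && (j1 == j))%:R
        - ((mon i' == (mon i1 + U_(w))%MM)
           && (mon j' == (mon j1 + U_(v))%MM))%:R.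
    rewrite !mxE !tprod_ordE !mulX_mxE -!natrM !mulnb di' dj'.
    rewrite !(inj_eq (@addIm _ _)) !(inj_eq (@mon_inj _ _)).
    by rewrite ![_ == i1]eq_sym ![_ == j1]eq_sym.
  case: (mon i' =P _) => [|_]; last by rewrite /= subr0.
  rewrite di' => /(congr1 (fun m : 'X_{1..n} => m w)).
  rewrite !mnmDE !mnm1E eqxx (negbTE nvw) addn0 addn1 => le_i1.
  by rewrite IH ?mul0r // -le_i1.
have := congr1 (fun x : 'rV_(_) => x 0 (tensor_ord i' j')) uK.
rewrite !mxE sum_tensor_ord (bigD1 i) //= [X in _ + X]big1 => [|i1 ni].
  rewrite (bigD1 j) //= big1 => [|j1 nj]; last first.
    by rewrite term (negbTE nj) andbF mulr0.
  by rewrite term !eqxx mulr1 !addr0.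
by rewrite big1 // => j1 _; rewrite term (negbTE ni) mulr0.
Qed.

End Polarization.

(** * Modules projective relative to M *)

Section RelativeProjectivity.
Variable k : fieldType.

(** The map v (x) y |-> phi(v) y, for a linear form phi. *)
Definition contract m c (phi : 'cV[k]_m) : 'M[k]_(m * c, c) :=
  bilin_mx (fun i j => phi i 0 *: row j 1%:M).

Lemma tprod_contract m m' c c' (B : 'M[k]_(m', m)) (D : 'M[k]_(c', c)) phi :
  tprod B D *m contract c phi = contract c' (B *m phi) *m D.
Proof.
apply: tensor_rowP => i j; rewrite row_tprod_mul row_mul row_bilin_mx.
rewrite -scalemxAl -row_mul mul1mx mxE scaler_suml; apply: eq_bigr => i' _.
rewrite [row j D]row_sum_delta scaler_sumr; apply: eq_bigr => j' _.
by rewrite row_bilin_mx !scalerA rowE mulmx1 mxE mulrAC.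
Qed.

Lemma tensor_vec_contract m c (u : 'rV[k]_m) (w : 'rV[k]_c) phi :
  tensor_vec u w *m contract c phi = (u *m phi) 0 0 *: w.
Proof.
apply/rowP => l; rewrite !mxE sum_tensor_ord mulr_suml.
apply: eq_bigr => i _; rewrite (bigD1 l) //= big1 => [|j nj].
  by rewrite tensor_vecE !mxE tensor_fstK tensor_sndK eqxx mulr1 addr0 mulrAC.
by rewrite !mxE !tensor_sndK (negbTE nj) !mulr0.
Qed.

Lemma contract_sum m c I (r : seq I) (P : pred I) (a : I -> k)
    (phi : I -> 'cV[k]_m) :
  contract c (\sum_(x <- r | P x) a x *: phi x)
  = \sum_(x <- r | P x) a x *: contract c (phi x).
Proof.
apply: tensor_rowP => i j; rewrite row_bilin_mx !raddf_sum summxE scaler_suml.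
by apply: eq_bigr => x _; rewrite [RHS]linearZ /= row_bilin_mx mxE scalerA.
Qed.

(** Let s be a section of M (x) g, where g : Y -> A (x) V and V is a summand of
    M through iota and pi.  Then
      t(a (x) v) = sum_m (e_m^* o pi (x) id) (s (iota v (x) (a (x) e_m)))
    is a section of g: applying g turns s (...) back into the element
    iota v (x) (a (x) e_m), and the sum of the e_m^*(v) (a (x) e_m) is a (x) v.
    In other words the identity of V is factored through V (x) V^* (x) V, by
    coevaluation on the right and evaluation on the left.  This works in every
    characteristic, whereas evaluating the coevaluation itself would give dim V,
    which vanishes in k when p divides it. *)
Lemma tensor_section (gT : finGroupType) (G : {group gT}) dM dA dV dY
    (M : mx_representation k G dM) (A : mx_representation k G dA)
    (V : mx_representation k G dV) (Y : mx_representation k G dY)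
    (iota : 'M_(dV, dM)) (pi : 'M_(dM, dV))
    (g : 'M_(dY, dA * dV)) (s : 'M_(dM * (dA * dV), dM * dY)) :
  {in G, forall x, V x *m iota = iota *m M x} ->
  {in G, forall x, M x *m pi = pi *m V x} -> iota *m pi = 1%:M ->
  {in G, forall x,
    tprod (M x) (tprod (A x) (V x)) *m s = s *m tprod (M x) (Y x)} ->
  s *m tprod (1%:M : 'M_dM) g = 1%:M ->
  exists2 t : 'M_(dA * dV, dY),
    {in G, forall x, tprod (A x) (V x) *m t = t *m Y x} & t *m g = 1%:M.
Proof.
move=> hom_iota hom_pi piK hom_s sK.
pose B (p : 'rV_dV) (a : 'rV_dA) (w : 'rV_dV) (phi : 'cV_dV) : 'rV[k]_dY :=
  tensor_vec (p *m iota) (tensor_vec a w) *m s *m contract dY (pi *m phi).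
pose t : 'M[k]_(dA * dV, dY) := bilin_mx (fun i j =>
  \sum_m B (row j 1%:M) (row i 1%:M) (row m 1%:M) (col m 1%:M)).
have B_pa p a w phi : B p a w phi
    = \sum_i \sum_j (a 0 i * p 0 j) *: B (row j 1%:M) (row i 1%:M) w phi.
  rewrite /B [in LHS](sum_row1 a) tensor_vec_suml tensor_vec_sumr !mulmx_suml.
  apply: eq_bigr => i _.
  rewrite [in LHS](sum_row1 p) mulmx_suml.
  under [X in tensor_vec X _]eq_bigr do rewrite -scalemxAl.
  rewrite tensor_vec_suml scaler_sumr !mulmx_suml.
  by apply: eq_bigr => j _; rewrite scalerA -!scalemxAl.
have B_w p a (Q : 'M_dV) m phi :
    B p a (row m Q) phi = \sum_l Q m l *: B p a (row l 1%:M) phi.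
  rewrite /B [in LHS](sum_row1 (row m Q)) !tensor_vec_sumr !mulmx_suml.
  by apply: eq_bigr => l _; rewrite -!scalemxAl mxE.
have B_phi p a w (c : 'I_dV -> k) (phi : 'I_dV -> 'cV_dV) :
    B p a w (\sum_l c l *: phi l) = \sum_l c l *: B p a w (phi l).
  rewrite /B mulmx_sumr; under eq_bigr do rewrite -scalemxAr.
  by rewrite contract_sum mulmx_sumr; apply: eq_bigr => l _; rewrite -scalemxAr.
have tE a p : tensor_vec a p *m t = \sum_m B p a (row m 1%:M) (col m 1%:M).
  rewrite tensor_vec_mul; under [RHS]eq_bigr do rewrite B_pa.
  rewrite [RHS]exchange_big; apply: eq_bigr => i _ /=.
  rewrite [RHS]exchange_big; apply: eq_bigr => j _ /=.
  by rewrite row_bilin_mx scaler_sumr.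
(* The element sum_m e_m (x) e_m^* is the same for every basis; this is what
   makes t equivariant. *)
have B_sum p a (Q R : 'M_dV) :
    \sum_m B p a (row m Q) (col m R)
    = \sum_m B p a (row m 1%:M) (col m (R *m Q)).
  under eq_bigr do rewrite B_w.
  rewrite exchange_big; apply: eq_bigr => l _ /=.
  rewrite -B_phi; congr (B _ _ _ _).
  apply/colP => i; rewrite !mxE summxE.
  by apply: eq_bigr => m _; rewrite !mxE mulrC.
have B_hom p a w phi x : x \in G ->
    B (p *m V x) (a *m A x) (w *m V x) phi = B p a w (V x *m phi) *m Y x.
  move=> Gx; rewrite /B -(mulmxA p) hom_iota // mulmxA -!tensor_vec_tprod.
  rewrite -[_ *m _ *m s]mulmxA hom_s // -!mulmxA; congr (_ *m (_ *m _)).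
  by rewrite tprod_contract (mulmxA (M x)) hom_pi // -!mulmxA.
have B_g p a w phi : B p a w phi *m g = (p *m phi) 0 0 *: tensor_vec a w.
  have -> : B p a w phi *m g = tensor_vec (p *m iota) (tensor_vec a w) *m
      (s *m tprod 1%:M g) *m contract _ (pi *m phi).
    by rewrite -!mulmxA tprod_contract mul1mx.
  by rewrite sK mulmx1 tensor_vec_contract mulmxA -(mulmxA p) piK mulmx1.
have rowM m n (Q : 'M[k]_(m, n)) l : row l Q = row l 1%:M *m Q.
  by rewrite -row_mul mul1mx.
have t_row i j :
    row (tensor_ord i j) t = tensor_vec (row i 1%:M) (row j 1%:M) *m t.
  by rewrite -row_tprod tprod1 -rowM.
exists t => [x Gx|]; apply: tensor_rowP => i j; rewrite row_mul.
  rewrite [RHS]row_mul row_tprod t_row (rowM _ _ (A x)) (rowM _ _ (V x)).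
  rewrite !tE mulmx_suml.
  have eV : 1%:M = V x^-1%g *m V x.
    by rewrite -repr_mxM ?groupV // mulVg repr_mx1.
  have VV : V x *m V x^-1%g = 1%:M.
    by rewrite -repr_mxM ?groupV // mulgV repr_mx1.
  under eq_bigr => m _.
    rewrite [X in row m X]eV (row_mul m) B_hom // colE mulmxA -colE.
    over.
  rewrite -!mulmx_suml; congr (_ *m _).
  by rewrite B_sum mulmx1 VV.
rewrite t_row tE mulmx_suml.
under eq_bigr => m _ do rewrite B_g colE mulmxA -colE mulmx1 mxE.
by rewrite -tensor_vec_sumr -sum_row1 -row_tprod tprod1.
Qed.

End RelativeProjectivity.

Section Modules.
Variables (k : fieldType) (gT : finGroupType) (G : {group gT}).
Local Notation kGmod := (representation k G).

Lemma rel_projective_tensor (M A V : kGmod)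
    (iota : 'M[k]_(rdegree V, rdegree M)) (pi : 'M[k]_(rdegree M, rdegree V)) :
  is_hom iota -> is_hom pi -> iota *m pi = 1%:M ->
  rel_projective M (tensor_grepr A V).
Proof.
move=> hom_iota hom_pi piK X Y f g _ [s hom_s sK].
exact: (tensor_section (A := A) hom_iota hom_pi piK hom_s sK).
Qed.

Lemma rel_projective0 (M : kGmod) : rel_projective M grepr0.
Proof.
move=> X Y f g _ _; exists 0 => [x _|]; first by rewrite mulmx0 mul0mx.
by rewrite mul0mx; apply/matrixP => -[].
Qed.

Lemma dsum_summand (I : eqType) (V : I -> kGmod) (r : seq I) i :
  i \in r -> let M := \big[dadd_grepr/grepr0]_(s <- r) V s in
  exists (iota : 'M[k]_(rdegree (V i), rdegree M))
         (pi : 'M[k]_(rdegree M, rdegree (V i))),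
    [/\ is_hom iota, is_hom pi & iota *m pi = 1%:M].
Proof.
elim: r => // s r IH; rewrite inE big_cons.
case: eqP => [-> _|_ /= /IH [iota [pi [hom_i hom_p piK]]]] /=.
  exists (row_mx 1%:M 0), (col_mx 1%:M 0); split=> [x Gx|x Gx|] /=.
  - by rewrite mul_mx_row mul_row_block !mulmx0 !mulmx1 !mul1mx mul0mx !addr0.
  - by rewrite mul_block_col mul_col_mx !mulmx0 !mulmx1 !mul1mx !mul0mx !addr0.
  - by rewrite mul_row_col mul1mx mul0mx addr0.
exists (row_mx 0 iota), (col_mx 0 pi); split=> [x Gx|x Gx|] /=.
- by rewrite mul_mx_row mul_row_block !mulmx0 !mul0mx addr0 add0r hom_i.
- by rewrite mul_block_col mul_col_mx !mulmx0 !mul0mx addr0 add0r hom_p.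
- by rewrite mul_row_col mul0mx add0r.
Qed.

(** * Splitting off a relatively projective summand *)

(** X is isomorphic to the direct sum of Y and the image of the idempotent
    u *m v, which factors through P.  This is all that the stable category sees,
    and unlike an isomorphism of X with Y (+) P it never requires reassociating
    direct sums. *)
Definition split_off (X Y P : kGmod) : Prop :=
  exists (f : 'M[k]_(rdegree X, rdegree Y)) (g : 'M[k]_(rdegree Y, rdegree X))
         (u : 'M[k]_(rdegree X, rdegree P)) (v : 'M[k]_(rdegree P, rdegree X)),
    [/\ is_hom f, is_hom g, is_hom u & is_hom v] /\
    (g *m f = 1%:M /\ f *m g + u *m v = 1%:M).

Lemma split_off_stable_iso (M X Y P : kGmod) :
  rel_projective M P -> split_off X Y P -> stable_iso M X Y.
Proof.
move=> projP [f [g [u [v [[hom_f hom_g hom_u hom_v] [gf fg_uv]]]]]].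
exists f, g; split=> //.
  exists P => //; exists (- u), v; split=> // [x Gx|].
    by rewrite mulmxN mulNmx hom_u.
  by rewrite -fg_uv opprD addrA subrr add0r mulNmx.
exists P => //; exists 0, 0; split=> [x _|x _|]; rewrite ?mulmx0 ?mul0mx //.
by rewrite gf subrr.
Qed.

Lemma split_off_iso0 (X Y P : kGmod) :
  mx_rsim X Y -> split_off X (dadd_grepr Y grepr0) P.
Proof.
case: X Y => [n X] [n' Y] [/= h dn]; case: n' / dn in Y h *.
rewrite row_free_unit => uh hom_h.
exists (row_mx h 0), (col_mx (invmx h) 0), 0, 0; split; first split=> x Gx /=.
- by rewrite mul_mx_row mul_row_block !mulmx0 !mul0mx addr0 add0r hom_h.
- rewrite mul_block_col mul_col_mx !mul0mx !mulmx0 addr0 add0r.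
  by congr col_mx; apply: canRL (mulKmx uh) _; rewrite mulmxA -hom_h // mulmxK.
- by rewrite mulmx0 mul0mx.
- by rewrite mulmx0 mul0mx.
split; last by rewrite mul_row_col !mul0mx !addr0 mulmxV.
rewrite mul_col_row mulVmx // mulmx0 !mul0mx.
apply: etrans (esym (scalar_mx_block _ _ _)).
by congr block_mx; apply/matrixP => i [].
Qed.

Lemma split_off_all (P : kGmod) : split_off P grepr0 P.
Proof.
exists 0, 0, 1%:M, 1%:M; split; first split=> x Gx.
- by rewrite mulmx0 mul0mx.
- by rewrite mulmx0 mul0mx.
- by rewrite mulmx1 mul1mx.
- by rewrite mulmx1 mul1mx.
by split; [apply/matrixP => -[] | rewrite mulmx0 add0r mulmx1].
Qed.

Lemma split_off_dadd (X Z X' Y P : kGmod) :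
  mx_rsim X (dadd_grepr Z X') -> split_off X' Y P ->
  split_off X (dadd_grepr Z Y) P.
Proof.
case: X => n X [h /= dn]; subst n.
rewrite row_free_unit => uh hom_h.
move=> [f [g [u [v [[hom_f hom_g hom_u hom_v] [gf fg_uv]]]]]].
have hom_h' x : x \in G ->
    block_mx (Z x) 0 0 (X' x) *m invmx h = invmx h *m X x.
  by move=> Gx; apply: canRL (mulKmx uh) _; rewrite mulmxA -hom_h // mulmxK.
exists (h *m block_mx 1%:M 0 0 f), (block_mx 1%:M 0 0 g *m invmx h),
       (h *m col_mx 0 u), (row_mx 0 v *m invmx h).
split; first split=> x Gx /=.
- rewrite mulmxA hom_h // -!mulmxA !mulmx_block; congr (_ *m _).
  by rewrite !mulmx0 !mul0mx !mulmx1 !mul1mx !addr0 !add0r hom_f.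
- rewrite -[RHS]mulmxA -hom_h' // !mulmxA !mulmx_block.
  by rewrite !mulmx0 !mul0mx !mulmx1 !mul1mx !addr0 !add0r hom_g.
- rewrite mulmxA hom_h // -!mulmxA mul_block_col mul_col_mx; congr (_ *m _).
  by rewrite !mulmx0 !mul0mx addr0 add0r hom_u.
- rewrite -[RHS]mulmxA -hom_h' // !mulmxA mul_mx_row mul_row_block.
  by rewrite !mulmx0 !mul0mx addr0 add0r hom_v.
split.
  rewrite mulmxA mulmxKV // mulmx_block.
  rewrite !mulmx0 !mul0mx !mulmx1 !addr0 !add0r gf.
  exact: esym (scalar_mx_block _ _ _).
rewrite !mulmxA -mulmxDl -!(mulmxA h) -mulmxDr.
rewrite mulmx_block mul_col_row add_block_mx.
rewrite !mulmx0 !mul0mx !mulmx1 !addr0 !add0r fg_uv.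
by rewrite -scalar_mx_block mulmx1 mulmxV.
Qed.

(** * Duality and direct sums *)

Definition dual_grepr (X : kGmod) : kGmod := Representation (dual_repr X).

Lemma mx_rsim_eq n (X Y : mx_representation k G n) :
  {in G, forall x, X x = Y x} -> mx_rsim X Y.
Proof.
move=> eXY; exists 1%:M => // [|x Gx]; first by rewrite row_free_unit unitmx1.
by rewrite eXY // mulmx1 mul1mx.
Qed.

Lemma mx_rsim_dual n n' (X : mx_representation k G n)
    (Y : mx_representation k G n') :
  mx_rsim X Y -> mx_rsim (dual_repr X) (dual_repr Y).
Proof.
case/mx_rsim_sym=> h dn; case: n / dn in X h *.
rewrite row_free_unit => uh hom_h.
exists h^T => // [|x Gx]; first by rewrite row_free_unit unitmx_tr.
by rewrite /= -!trmx_mul hom_h ?groupV.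
Qed.

Lemma mx_rsim_dual_tensor (X Y : kGmod) :
  mx_rsim (dual_grepr (tensor_grepr X Y))
          (tensor_grepr (dual_grepr X) (dual_grepr Y)).
Proof. by apply: mx_rsim_eq => x Gx /=; rewrite trmx_tprod. Qed.

Lemma mx_rsim_dual_dadd (X Y : kGmod) :
  mx_rsim (dual_grepr (dadd_grepr X Y))
          (dadd_grepr (dual_grepr X) (dual_grepr Y)).
Proof. by apply: mx_rsim_eq => x Gx /=; rewrite tr_block_mx !trmx0. Qed.

Lemma mx_rsim_daddr (Z X Y : kGmod) :
  mx_rsim X Y -> mx_rsim (dadd_grepr Z X) (dadd_grepr Z Y).
Proof.
case: X Y => [n X] [n' Y] [/= h dn]; case: n' / dn in Y h *.
rewrite row_free_unit => uh hom_h.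
exists (block_mx 1%:M 0 0 h) => // [|x Gx] /=.
  by rewrite row_free_unit unitmxE det_ublock det1 mul1r -unitmxE.
by rewrite !mulmx_block !mulmx0 !mul0mx !mulmx1 !mul1mx !addr0 !add0r hom_h.
Qed.

End Modules.

(** * The Clebsch-Gordan splitting of binary forms *)

Section BinaryForms.
Variables (k : fieldType) (gT : finGroupType) (G : {group gT}).
Variable (W : mx_representation k G 2).
Local Notation Sym d := (Representation (sym_repr W d)).

(** The group acts on x_0 (x) x_1 - x_1 (x) x_0 through the determinant. *)
Lemma wedge_hom a b (A : 'M[k]_2) :
  wedge_mx k ord0 ord_max a b *m tprod (sym_mx a.+1 A) (sym_mx b.+1 A)
  = \det A *: (tprod (sym_mx a A) (sym_mx b A) *m wedge_mx k ord0 ord_max a b).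
Proof.
rewrite mulmxBl mulmxBr -!tprodE !mulX_sym.
rewrite !big_ord_recl !big_ord0 !addr0 !(tprodDl, tprodDr, tprodZl, tprodZr).
rewrite (expand_det_row _ ord0) !big_ord_recl big_ord0 /cofactor !det_mx11 !mxE.
have -> : lift ord0 ord0 = ord_max :> 'I_2 by apply/val_inj.
have -> : lift ord_max 0 = ord0 :> 'I_2 by apply/val_inj.
move: (tprod _ _) (tprod _ (_ *m mulX_mx k ord_max b))
  (tprod (_ *m mulX_mx k ord_max a) _) (tprod (_ *m mulX_mx k ord_max a) _)
  => T00 T01 T10 T11.
apply/matrixP => i j; rewrite !mxE /=; ring.
Qed.

Lemma sym_tensor0l b : mx_rsim (tensor_grepr (Sym 0) (Sym b)) (Sym b).
Proof.
apply: mx_rsim_sym.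
have [s [hom_s s_mult]] := @mult_section k 2 0 b b (erefl _).
exists s => [||x Gx] /=; last exact: hom_s.
  by rewrite !card_monom2 mul1n.
by apply/row_freeP; exists (mult_mx k 2 0 b b); rewrite s_mult ffactn0.
Qed.

(** The section of multiplication used here has composite a!, since it polarizes
    all of S^a to the left. *)
Lemma sym_tensor0r a :
  (a`!)%:R != 0 :> k -> mx_rsim (tensor_grepr (Sym a) (Sym 0)) (Sym a).
Proof.
move=> nz; apply: mx_rsim_sym.
have [s [hom_s s_mult]] := @mult_section k 2 a 0 a (addn0 a).
exists s => [||x Gx] /=; last exact: hom_s.
  by rewrite !card_monom2 muln1.
apply/row_freeP; exists ((a`!)%:R^-1 *: mult_mx k 2 a 0 a).
by rewrite -scalemxAr s_mult ffactnn scale_scalar_mx mulVf.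
Qed.

(** The section of multiplication and the wedge map form together a square
    matrix because (a + b + 3) + (a + 1) (b + 1) = (a + 2) (b + 2); its rows are
    free because multiplication kills the wedge part and is a nonzero scalar on
    the image of the section. *)
Lemma sym_clebsch_gordan a b :
  {in G, forall x, \det (W x) = 1} -> ((a + b).+2 ^_ a.+1)%:R != 0 :> k ->
  mx_rsim (tensor_grepr (Sym a.+1) (Sym b.+1))
          (dadd_grepr (Sym (a + b).+2) (tensor_grepr (Sym a) (Sym b))).
Proof.
move=> detW nz; apply: mx_rsim_sym.
have [|s [hom_s s_mult]] := @mult_section k 2 a.+1 b.+1 (a + b).+2.
  by rewrite addSn addnS.
pose kap := wedge_mx k (ord0 : 'I_2) ord_max a b.
exists (col_mx s kap) => [||x Gx] /=.
- rewrite !card_monom2; nia.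
- rewrite -kermx_eq0; apply/rowV0P => u /sub_kermxP.
  rewrite -[u]hsubmxK mul_row_col => uK.
  have := congr1 (mulmxr (mult_mx k 2 a.+1 b.+1 (a + b).+2)) uK.
  rewrite /= mul0mx mulmxDl -!mulmxA wedge_mult // mulmx0 addr0 s_mult.
  rewrite mul_mx_scalar => /eqP; rewrite scaler_eq0 (negbTE nz) /= => /eqP ul0.
  move: uK; rewrite ul0 mul0mx add0r => /eqP.
  by rewrite mulmx_free_eq0 ?wedge_free // => /eqP ->; rewrite row_mx0.
rewrite mul_block_col mul_col_mx !mul0mx addr0 add0r hom_s; congr col_mx.
by rewrite wedge_hom detW // scale1r.
Qed.

End BinaryForms.

(** * Iterating the splitting *)

Section Vmod.
Variables (k : fieldType) (gT : finGroupType) (G : {group gT}).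
Variable (W : mx_representation k G 2).
Local Notation Sym d := (Representation (sym_repr W d)).
Local Notation V := (Vmod W).

Lemma Vmod_tensor1l j : mx_rsim (tensor_grepr (V 1) (V j)) (V j).
Proof.
apply: mx_rsim_trans (mx_rsim_sym (mx_rsim_dual_tensor (Sym 0) (Sym j.-1))) _.
exact/mx_rsim_dual/sym_tensor0l.
Qed.

Lemma Vmod_tensor1r i :
  ((i.-1)`!)%:R != 0 :> k -> mx_rsim (tensor_grepr (V i) (V 1)) (V i).
Proof.
move=> nz.
apply: mx_rsim_trans (mx_rsim_sym (mx_rsim_dual_tensor (Sym i.-1) (Sym 0))) _.
exact/mx_rsim_dual/sym_tensor0r.
Qed.

Lemma Vmod_clebsch_gordan i j :
  {in G, forall x, \det (W x) = 1} -> ((i + j).+2 ^_ i.+1)%:R != 0 :> k ->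
  mx_rsim (tensor_grepr (V i.+2) (V j.+2))
          (dadd_grepr (V (i + j).+3) (tensor_grepr (V i.+1) (V j.+1))).
Proof.
move=> detW nz.
apply: mx_rsim_trans
  (mx_rsim_sym (mx_rsim_dual_tensor (Sym i.+1) (Sym j.+1))) _.
apply: mx_rsim_trans (mx_rsim_dual (sym_clebsch_gordan detW nz)) _.
apply: mx_rsim_trans (mx_rsim_dual_dadd _ _) _.
exact/mx_rsim_daddr/(mx_rsim_dual_tensor (Sym i) (Sym j)).
Qed.

Lemma ffact_natf_neq0 p c a : p \in [pchar k] ->
  (forall t, (t < a)%N -> ~~ (p %| c - t)%N) -> (c ^_ a)%:R != 0 :> k.
Proof.
move=> charp; elim: a => [|a IH] ndvd; first by rewrite ffactn0 oner_neq0.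
rewrite ffactnSr natrM mulf_neq0 ?IH // => [t lt_t|].
  by apply: ndvd; apply: ltnW.
by rewrite -(dvdn_pcharf charp) ndvd.
Qed.

(** The determinant is a p-th root of unity, and Frobenius is injective. *)
Lemma det_repr_abelem p : p \in [pchar k] -> (p.-abelem G)%g ->
  {in G, forall x, \det (W x) = 1}.
Proof.
move=> charp abelG x Gx; have pr_p := pcharf_prime charp.
have [_ /(_ x Gx) xp1] := abelemP pr_p abelG.
have det_exp m : \det (W (x ^+ m)%g) = \det (W x) ^+ m.
  elim: m => [|m IH]; first by rewrite expg0 repr_mx1 det1 expr0.
  by rewrite expgS repr_mxM ?groupX // det_mulmx IH exprS.
apply: (fmorph_inj (pFrobenius_aut charp)).
by rewrite rmorph1 -[LHS]/(\det (W x) ^+ p) -det_exp xp1 repr_mx1 det1.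
Qed.

(** Induction on i, with r fixed and j' decreasing along with i.  The recursion
    stops at j' = 0, where nothing but V_i (x) V_(r p) is left (then r > 0 since
    j > 0), at i = 1, or at j = 1; in the last two cases V_i (x) V_j is itself
    the single remaining summand. *)
Lemma Vmod_tensor_split p (M : representation k G) r : p \in [pchar k] ->
  {in G, forall x, \det (W x) = 1} ->
  ((0 < r)%N -> forall A, rel_projective M (tensor_grepr A (V (r * p)))) ->
  forall i j j',
    (0 < i)%N -> (0 < j)%N -> j = (r * p + j')%N -> (i + j' <= p)%N ->
  exists2 P, rel_projective M P &
    split_off (tensor_grepr (V i) (V j))
      (\big[dadd_grepr/grepr0]_(1 <= l < (minn i j').+1)
          V (j + i - (2 * l - 1))%N) P.
Proof.
move=> charp detW projV; have p_gt1 := prime_gt1 (pcharf_prime charp).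
have ndvd m : (0 < m < p)%N -> ~~ (p %| r * p + m)%N.
  by case/andP=> m0 mp; rewrite dvdn_addr ?dvdn_mull // gtnNdvd.
elim=> // i IH j [|j'] _ j0 dj le_ij.
  rewrite minn0 big_geq // dj addn0.
  exists (tensor_grepr (V i.+1) (V (r * p)%N)).
    by apply: projV; case: (r) dj j0 => // ->.
  exact: split_off_all.
have [i0|i_gt0] := posnP i.
  rewrite i0 minnSS min0n big_ltn // big_geq //.
  have -> : (j + 1 - (2 * 1 - 1))%N = j by lia.
  exists grepr0; [exact: rel_projective0 | exact/split_off_iso0/Vmod_tensor1l].
rewrite minnSS big_ltn // big_add1 /=.
have [j1|j_gt1] := eqVneq j 1%N.
  have [r0 j'0] : r = 0%N /\ j' = 0%N by move: dj; rewrite j1; nia.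
  rewrite j'0 minn0 big_geq // j1.
  have -> : (1 + i.+1 - (2 * 1 - 1))%N = i.+1 by lia.
  exists grepr0; [exact: rel_projective0 | apply/split_off_iso0/Vmod_tensor1r].
  rewrite -ffactnn; apply: (ffact_natf_neq0 charp) => t lt_t.
  by rewrite gtnNdvd //; lia.
case: i i_gt0 IH le_ij => // i _ IH le_ij.
case: j j0 dj j_gt1 => // -[] // j _ dj _.
have dj' : j.+1 = (r * p + j')%N by lia.
have le_ij' : (i.+1 + j' <= p)%N by lia.
have [P projP splitP] := IH j.+1 j' isT isT dj' le_ij'.
exists P => //; have -> : (j.+2 + i.+2 - (2 * 1 - 1))%N = (i + j).+3 by lia.
apply: split_off_dadd (Vmod_clebsch_gordan detW _) _.
  apply: (ffact_natf_neq0 charp) => t lt_t.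
  (* The factors are r p + m with j' < m < p, hence prime to p. *)
  have -> : ((i + j).+2 - t = r * p + (i + j'.+1 - t))%N by lia.
  by apply: ndvd; lia.
rewrite [X in split_off _ X _](_ : _ =
  \big[dadd_grepr/grepr0]_(1 <= l < (minn i.+1 j').+1)
    V (j.+1 + i.+1 - (2 * l - 1))%N) //.
by apply: eq_big_nat => l /andP[l_gt0 _]; congr (V _); lia.
Qed.

End Vmod.

Theorem corollary1p2 (p n : nat) (k : fieldType) (gT : finGroupType)
    (G : {group gT}) (W : mx_representation k G 2) (i j r j' : nat) :
  prime p -> p \in [pchar k] ->
  (1 <= n)%N -> (p.-abelem G)%g -> #|G| = (p ^ n)%N ->
  mx_faithful W -> mx_indecomposable W ->
  (0 < i < p)%N -> (0 < j < p ^ n)%N -> (i + j <= p ^ n)%N ->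
  j = (r * p + j')%N -> (j' < p)%N -> (i + j' <= p)%N ->
  let V := Vmod W in
  let M := \big[dadd_grepr/grepr0]_(1 <= s < (p ^ n.-1).+1) V (s * p)%N in
  stable_iso M
    (tensor_grepr (V i) (V j))
    (\big[dadd_grepr/grepr0]_(1 <= l < (minn i j').+1)
        V (j + i - (2 * l - 1))%N).
Proof.
move=> pr_p charp n_gt0 abelG _ _ _ /andP[i_gt0 _] /andP[j_gt0 j_lt] _ dj _.
move=> le_ij V M.
have projV : (0 < r)%N ->
    forall A, rel_projective M (tensor_grepr A (V (r * p)%N)).
  move=> r_gt0 A.
  have r_in : r \in index_iota 1 (p ^ n.-1).+1.
    rewrite mem_index_iota r_gt0 ltnS /= -(leq_pmul2r (prime_gt0 pr_p)) -expnSr.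
    by rewrite prednK // ltnW // (leq_ltn_trans _ j_lt) // dj leq_addr.
  have [iota [pi [hom_iota hom_pi piK]]] :=
    dsum_summand (fun s => V (s * p)%N) r_in.
  exact: rel_projective_tensor hom_iota hom_pi piK.
have detW := det_repr_abelem W charp abelG.
have [P projP splitP] :=
  Vmod_tensor_split charp detW projV i_gt0 j_gt0 dj le_ij.
exact: split_off_stable_iso projP splitP.
Qed.
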